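(* If the Minimum Circuit Size Problem on inputs of length $N$ can be computed by some function in ${\sf FORMULA}[s]\circ{\sf XOR}$ (on $N$ input bits), then $s=\tilde\Omega(N^2)$, i.e. $s\ge N^2/\mathrm{polylog}(N)$.
   Context: A de Morgan formula is a rooted tree whose internal gates are AND, OR (fan-in 2) and NOT (fan-in 1) and whose leaves are labelled by inputs; its size is the number of leaves. ${\sf FORMULA}[s]\circ{\sf XOR}$ is the class of functions $F(g_1(x),\dots,g_s(x))$ where $F$ is a de Morgan formula of size at most $s$ and each $g_i$ is a parity function $x\mapsto\bigoplus_{i\in S}x_i$ or its negation. Minimum Circuit Size Problem (MCSP): the input (of total length $N$, in a fixed encoding) consists of the truth table of a function $f\colon\{0,1\}^{\log n}\to\{0,1\}$ (an $n$-bit string) and a string $1^\ell$; the answer is $1$ iff $f$ has Boolean circuit complexity at most $\ell$. *)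

(* Defs.v *)
From mathcomp Require Import all_boot.
Set Implicit Arguments. Unset Strict Implicit. Unset Printing Implicit Defensive.

(* Wires 0..m-1 are the inputs; gate number k (0-based) defines wire m + k. *)
Inductive gate := GAnd of nat & nat | GOr of nat & nat | GNot of nat.

Definition gate_val (vals : seq bool) (g : gate) : bool :=
  match g with
  | GAnd i j => nth false vals i && nth false vals j
  | GOr i j => nth false vals i || nth false vals j
  | GNot i => ~~ nth false vals i
  end.

Definition gate_refs_lt (k : nat) (g : gate) : bool :=
  match g with
  | GAnd i j => (i < k) && (j < k)
  | GOr i j => (i < k) && (j < k)
  | GNot i => i < k
  end.

Fixpoint wf_gates (k : nat) (gs : seq gate) : bool :=
  match gs with
  | [::] => true
  | g :: gs' => gate_refs_lt k g && wf_gates k.+1 gs'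
  end.

Fixpoint eval_gates (vals : seq bool) (gs : seq gate) : seq bool :=
  match gs with
  | [::] => vals
  | g :: gs' => eval_gates (rcons vals (gate_val vals g)) gs'
  end.

Definition bits (m i : nat) : seq bool := [seq odd (i %/ 2 ^ j) | j <- iota 0 m].

Definition circuit_size_le (m : nat) (tt : seq bool) (l : nat) : Prop :=
  exists (gs : seq gate) (out : nat),
    [/\ wf_gates m gs, out < m + size gs, size gs <= l &
        forall i, i < 2 ^ m ->
          nth false (eval_gates (bits m i) gs) out = nth false tt i].

(* Fixed encoding: for n = 2^m, an input of length N = 2n is (tt, y) with
   tt the first n bits (truth table) and y the last n bits, where y must be
   1^l 0^(n-l) (unary encoding of the size parameter l, padded). Inputs whose
   second half is not of this form are NO instances. *)
Definition MCSP_yes (m : nat) (x : seq bool) : Prop :=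
  exists l, [/\ l <= 2 ^ m,
    drop (2 ^ m) x = nseq l true ++ nseq (2 ^ m - l) false &
    circuit_size_le m (take (2 ^ m) x) l].

Inductive formula (V : Type) :=
  | FLeaf of V
  | FAnd of formula V & formula V
  | FOr of formula V & formula V
  | FNot of formula V.

Fixpoint fsize V (F : formula V) : nat :=
  match F with
  | FLeaf _ => 1
  | FAnd F1 F2 => fsize F1 + fsize F2
  | FOr F1 F2 => fsize F1 + fsize F2
  | FNot F1 => fsize F1
  end.

Fixpoint feval V (a : V -> bool) (F : formula V) : bool :=
  match F with
  | FLeaf v => a v
  | FAnd F1 F2 => feval a F1 && feval a F2
  | FOr F1 F2 => feval a F1 || feval a F2
  | FNot F1 => ~~ feval a F1
  end.

Definition parity N (g : {set 'I_N} * bool) (x : N.-tuple bool) : bool :=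
  g.2 (+) \big[addb/false]_(i in g.1) tnth x i.

Definition in_FORMULA_XOR (N s : nat) (h : N.-tuple bool -> bool) : Prop :=
  exists (F : formula 'I_s) (g : 'I_s -> {set 'I_N} * bool),
    fsize F <= s /\ forall x, feval (fun i => parity (g i) x) F = h x.

(* Main.v *)
Require Import Defs.
From mathcomp Require Import all_boot.
From mathcomp Require Import all_order all_algebra.
From mathcomp Require Import ring lra zify realalg.
Set Implicit Arguments. Unset Strict Implicit. Unset Printing Implicit Defensive.
Import Order.TTheory GRing.Theory Num.Theory.

(* By induction, a formula of size s has dual-adversary vectors u_x (for f x = 1)
   and v_y (for f y = 0), indexed by its leaves, with |u_x|^2 |v_y|^2 <= s and
   <u_x, v_y> = 1 once the sum is restricted to the leaves where x and y differ.
   They yield a fixed reflection L and diagonal matrices P_x, whose entries are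
   signs of the leaves at x, such that the mean p x of the <e, (L P_x)^j e>,
   j < k, is close to 1 or to 0 according to f x as soon as k is a large multiple
   of sqrt s. When the leaves are parities, expanding the k products writes p as
   a combination of characters with coefficients of total size O(s)^k, so p
   cannot distinguish the uniform distribution from a distribution of bias
   O(s)^(-k).

   Such a distribution is the xor of t = O~(k) independent copies of the indicator
   of a random affine subspace of random codimension, multiplied by a random
   bit: by Valiant-Vazirani isolation one copy has bias at most 1 - 1/O(m). Its
   truth tables have circuits of size O~(sqrt s). If s < N^2 / polylog N, this is
   at most N / polylog N, a size that a counting argument shows is exceeded by
   almost all truth tables; hence no such formula computes MCSP. *)

Local Open Scope ring_scope.

(** * Reflections, and polynomials from formulas *)

Section Dot.
Variables (R : realFieldType) (n : nat).
Implicit Types u v w : 'cV[R]_n.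

Definition dot u v : R := \sum_i u i 0 * v i 0.

Lemma dotC u v : dot u v = dot v u.
Proof. by apply: eq_bigr => i _; rewrite mulrC. Qed.

Lemma dotDr u v w : dot u (v + w) = dot u v + dot u w.
Proof. by rewrite -big_split; apply: eq_bigr => i _; rewrite mxE mulrDr. Qed.

Lemma dotZr c u v : dot u (c *: v) = c * dot u v.
Proof. by rewrite big_distrr; apply: eq_bigr => i _; rewrite mxE mulrCA. Qed.

Lemma dotNr u v : dot u (- v) = - dot u v.
Proof. by rewrite -scaleN1r dotZr mulN1r. Qed.

Lemma dotBr u v w : dot u (v - w) = dot u v - dot u w.
Proof. by rewrite dotDr dotNr. Qed.

Lemma dotE u v : u^T *m v = (dot u v)%:M.
Proof.
apply/matrixP => i j; rewrite !ord1 !mxE eqxx mulr1n.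
by apply: eq_bigr => k _; rewrite mxE.
Qed.

Lemma dot_mulmx (M : 'M_n) u v : dot u (M *m v) = dot (M^T *m u) v.
Proof.
have /matrixP/(_ 0 0) : (u^T *m (M *m v)) = ((M^T *m u)^T *m v).
  by rewrite trmx_mul trmxK mulmxA.
by rewrite !dotE !mxE eqxx !mulr1n.
Qed.

Lemma dot_ge0 u : 0 <= dot u u.
Proof. by apply: sumr_ge0 => i _; rewrite -expr2 sqr_ge0. Qed.

Lemma dot_eq0 u : (dot u u == 0) = (u == 0).
Proof.
apply/eqP/eqP => [h|->]; last by apply: big1 => i _; rewrite mxE mul0r.
apply/colP => i; rewrite mxE; apply/eqP; rewrite -sqrf_eq0 expr2.
by rewrite (psumr_eq0P _ h) // => j _; rewrite -expr2 sqr_ge0.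
Qed.

(** Cauchy-Schwarz against a unit vector, read off from the nonnegative squared length of
    [v - dot u v *: u]. *)
Lemma dot_le (c : R) u v :
  dot u u = 1 -> 0 <= c -> dot v v <= c ^+ 2 -> `|dot u v| <= c.
Proof.
move=> u1 c0 vc; rewrite -(ler_pXn2r (ltn0Sn 1)) ?nnegrE // real_normK ?num_real //.
apply: le_trans vc; have := dot_ge0 (v - dot u v *: u).
rewrite dotBr dotZr ![dot (v - _) _]dotC !dotBr !dotZr u1 [dot v u]dotC; lra.
Qed.

(** Gram-Schmidt: [Q] is the orthogonal projection onto the complement of the span of [S], and
    [L = 2 Q - 1]. A new vector [x] contributes the rank-one projection onto [Q x], or nothing when
    [Q x = 0]. *)
Lemma orthogonal_reflection (S : seq 'cV[R]_n) :
  exists L : 'M[R]_n,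
    [/\ L^T = L, L *m L = 1%:M, forall v, v \in S -> L *m v = - v &
        forall w, (forall v, v \in S -> dot v w = 0) -> L *m w = w].
Proof.
suff [Q [QT QQ Q0 Q1]] : exists Q : 'M[R]_n,
    [/\ Q^T = Q, Q *m Q = Q, forall v, v \in S -> Q *m v = 0 &
        forall w, (forall v, v \in S -> dot v w = 0) -> Q *m w = w].
  exists (Q + Q - 1%:M); split.
  - by rewrite linearB linearD /= QT trmx1.
  - rewrite mulmxBl mulmxBr !mulmxDl !mulmxDr !mulmx1 !mul1mx QQ.
    by rewrite addrK opprB addrCA subrr addr0.
  - by move=> v vS; rewrite mulmxBl mulmxDl mul1mx Q0 // !add0r.
  - by move=> w wS; rewrite mulmxBl mulmxDl mul1mx Q1 // addrK.
elim: S => [|x S [Q [QT QQ Q0 Q1]]].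
  by exists 1%:M; split; rewrite ?trmx1 ?mulmx1 // => w _; rewrite mul1mx.
have [y yE] : exists y, y = Q *m x by exists (Q *m x).
have [y0|y0] := eqVneq y 0.
  exists Q; split=> // [v|w hw]; last by apply: Q1 => v vS; apply: hw; rewrite inE vS orbT.
  by rewrite inE => /predU1P[->|/Q0]; rewrite -?yE.
have d0 : dot y y != 0 by rewrite dot_eq0.
have Qy : Q *m y = y by rewrite yE mulmxA QQ.
have yQ : y^T *m Q = y^T by rewrite -[in LHS]QT -trmx_mul Qy.
have mulE v : (y *m y^T) *m v = dot y v *: y.
  by rewrite -mulmxA dotE mul_mx_scalar.
exists (Q - (dot y y)^-1 *: (y *m y^T)); split.
- by rewrite linearB linearZ /= trmx_mul trmxK QT.
- rewrite mulmxBl !mulmxBr QQ -!scalemxAl -!scalemxAr.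
  rewrite !mulmxA Qy.
  rewrite -(mulmxA y y^T Q) yQ -(mulmxA y y^T y) dotE mul_mx_scalar -scalemxAl.
  by rewrite (scalerA (dot y y)^-1 (dot y y)) mulVf // scale1r subrr subr0.
- move=> v; rewrite inE mulmxBl -scalemxAl mulE => /predU1P[->|vS].
    suff -> : dot y x = dot y y by rewrite scalerA mulVf // scale1r -yE subrr.
    by rewrite -{1}Qy -{1}QT -dot_mulmx -yE.
  rewrite Q0 // (_ : dot y v = 0) ?scale0r ?scaler0 ?subr0 //.
  rewrite -Qy -{1}QT -dot_mulmx Q0 //.
  by apply: big1 => i _; rewrite mxE mulr0.
- move=> w hw; have Qw : Q *m w = w by apply: Q1 => v vS; apply: hw; rewrite inE vS orbT.
  rewrite mulmxBl -scalemxAl mulE Qw (_ : dot y w = 0) ?scale0r ?scaler0 ?subr0 //.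
  by rewrite yE -{1}QT -dot_mulmx Qw hw ?mem_head.
Qed.

Variables (L P : 'M[R]_n).
Hypotheses (LT : L^T = L) (LL : L *m L = 1%:M) (PT : P^T = P) (PP : P *m P = 1%:M).

Definition walk j v := iter j (fun v => L *m (P *m v)) v.

Lemma walk_is_linear j c u v : walk j (c *: u + v) = c *: walk j u + walk j v.
Proof. by elim: j => //= j ->; rewrite !mulmxDr -!scalemxAr. Qed.

Lemma walkB j u v : walk j (u - v) = walk j u - walk j v.
Proof. by rewrite addrC -scaleN1r walk_is_linear scaleN1r addrC. Qed.

Lemma dot_walk j u : dot (walk j u) (walk j u) = dot u u.
Proof.
elim: j => //= j <-.
by rewrite dot_mulmx LT mulmxA LL mul1mx dot_mulmx PT mulmxA PP mul1mx.
Qed.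

Lemma walk_fixed j u : P *m u = u -> L *m u = u -> walk j u = u.
Proof. by move=> Pu Lu; elim: j => //= j ->; rewrite Pu Lu. Qed.

(** A Cesaro mean as in the mean ergodic theorem: for large [k] it approaches the squared length of
    the projection of [u] onto the vectors fixed by [L P]. *)
Definition walk_mean k u := (\sum_(j < k) dot u (walk j u)) / k%:R.

Lemma walk_mean_le1 k u : dot u u = 1 -> walk_mean k u <= 1.
Proof.
move=> u1; have [->|k0] := posnP k; first by rewrite /walk_mean big_ord0 mul0r.
rewrite ler_pdivrMr ?ltr0n // mul1r -[k in _ <= k%:R]card_ord -sumr_const.
apply: ler_sum => j _; apply: le_trans (ler_norm _) _.
by apply: dot_le; rewrite ?dot_walk ?u1 ?expr1n.
Qed.

(** Since the walk fixes [w], [<u, (L P)^j u> = <u, w> - <u, (L P)^j (w - u)>], and the walk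
    preserves the length of [w - u]. *)
Lemma walk_mean_fixed k (c : R) u w :
  (0 < k)%N -> dot u u = 1 -> dot u w = 1 -> P *m w = w -> L *m w = w ->
  0 <= c -> dot (w - u) (w - u) <= c ^+ 2 -> 1 - c <= walk_mean k u.
Proof.
move=> k0 u1 uw Pw Lw c0 wu; rewrite ler_pdivlMr ?ltr0n //.
rewrite mulr_natr -[k in _ *+ k]card_ord -sumr_const.
apply: ler_sum => j _; rewrite -[X in walk j X](subKr w) walkB walk_fixed //.
rewrite dotBr uw lerD2l lerN2; apply: le_trans (ler_norm _) _.
by apply: dot_le; rewrite ?dot_walk.
Qed.

(* 2 u = g - R g with R = L P, so the sum of the R^j u telescopes *)
Lemma walk_mean_moved k (c : R) u w :
  (0 < k)%N -> dot u u = 1 -> w + P *m w = u + u -> L *m w = - w ->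
  0 <= c -> dot w w <= c ^+ 2 -> walk_mean k u <= c / k%:R.
Proof.
move=> k0 u1 Pw Lw c0 wc; rewrite ler_pM2r ?invr_gt0 ?ltr0n //.
set g := P *m w; have gg : dot g g = dot w w.
  by rewrite /g dot_mulmx PT mulmxA PP mul1mx.
have tel : \sum_(j < k) dot u (walk j u) *+ 2 = dot u g - dot u (walk k g).
  have -> : dot u g - dot u (walk k g) =
            - \sum_(0 <= j < k) (dot u (walk j.+1 g) - dot u (walk j g)).
    by rewrite telescope_sumr // opprB.
  rewrite big_mkord -sumrN; apply: eq_bigr => j _.
  rewrite opprB mulr2n -!dotDr -dotBr.
  have -> : walk j u + walk j u = walk j (u + u).
    by rewrite -{3}[u]scale1r walk_is_linear scale1r.
  have -> : u + u = g - L *m (P *m g).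
    by rewrite /g [P *m (P *m w)]mulmxA PP mul1mx Lw opprK [RHS]addrC Pw.
  by rewrite walkB /walk -iterSr.
have b1 : `|dot u g| <= c by apply: dot_le; rewrite ?gg.
have b2 : `|dot u (walk k g)| <= c by apply: dot_le; rewrite ?dot_walk ?gg.
move: tel b1 b2; rewrite sumrMnl !ler_norml mulr2n => tel /andP[_ b1] /andP[b2 _]; lra.
Qed.

End Dot.

(** * Dual adversary vectors of a formula and the walk built from them *)

Lemma fsize_gt0 V (F : formula V) : (0 < fsize F)%N.
Proof. by elim: F => //= F1 h1 F2 h2; rewrite addn_gt0 h1. Qed.

(** [A] shifts weight between the two families. At an AND, [u] joins both subformulas while [v]
    lives on one that is false; OR is the mirror image, and NOT exchanges [u] and [v] with [A]
    replaced by [s / A]. *)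
Lemma formula_certificate (R : rcfType) (V : Type) (F : formula V) (A : R) :
  0 < A ->
  exists (J : finType) (lab : J -> V) (u v : (V -> bool) -> J -> R),
    [/\ #|J| = fsize F,
        forall a, feval a F -> \sum_j u a j ^+ 2 <= A,
        forall a, ~~ feval a F -> \sum_j v a j ^+ 2 <= (fsize F)%:R / A &
        forall a b, feval a F -> ~~ feval b F ->
          \sum_(j | a (lab j) != b (lab j)) u a j * v b j = 1].
Proof.
elim: F A => [x|F1 IH1 F2 IH2|F1 IH1 F2 IH2|F IH] A A0 /=.
- exists unit, (fun=> x), (fun _ _ => Num.sqrt A), (fun _ _ => (Num.sqrt A)^-1).
  have s0 : Num.sqrt A != 0 by rewrite gt_eqF ?sqrtr_gt0.
  split=> [|a _|a _|a b ha hb]; first by rewrite card_unit.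
  + by rewrite big_const card_unit /= addr0 sqr_sqrtr // ltW.
  + by rewrite big_const card_unit /= addr0 exprVn sqr_sqrtr ?mul1r // ltW.
  + rewrite (eq_bigl xpredT); last by move=> i; rewrite ha (negbTE hb).
    by rewrite big_const card_unit /= addr0 divff.
- have n1 := fsize_gt0 F1; have n2 := fsize_gt0 F2.
  set s1 := fsize F1 in n1 *; set s2 := fsize F2 in n2 *.
  have r1 : 0 < s1%:R :> R by rewrite ltr0n.
  have r2 : 0 < s2%:R :> R by rewrite ltr0n.
  have r12 : 0 < (s1 + s2)%:R :> R by rewrite natrD addr_gt0.
  (* Splitting [A] in proportion to the sizes makes the [u] bounds add up to [A] and turns both [v]
     bounds into [(s1 + s2) / A]. *)
  have [|J1 [l1 [u1 [v1 [c1 U1 V1 E1]]]]] := IH1 (A * s1%:R / (s1 + s2)%:R).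
    by rewrite divr_gt0 ?mulr_gt0.
  have [|J2 [l2 [u2 [v2 [c2 U2 V2 E2]]]]] := IH2 (A * s2%:R / (s1 + s2)%:R).
    by rewrite divr_gt0 ?mulr_gt0.
  exists (J1 + J2)%type,
   (fun j => match j with inl j => l1 j | inr j => l2 j end),
   (fun a j => match j with inl j => u1 a j | inr j => u2 a j end),
   (fun a j => match j with inl j => if feval a F1 then 0 else v1 a j
                          | inr j => if feval a F1 then v2 a j else 0 end).
  split=> [|a /andP[h1 h2]|a|a b /andP[h1 h2]].
  + by rewrite card_sum c1 c2.
  + rewrite big_sumType /= (le_trans (lerD (U1 _ h1) (U2 _ h2))) //.
    by rewrite -mulrDl -mulrDr -natrD mulfK ?gt_eqF.
  + rewrite big_sumType /=; case: (boolP (feval a F1)) => /= h1 h2.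
      rewrite big1 ?add0r => [|i _]; last by rewrite expr0n.
      apply: le_trans (V2 _ h2) _; rewrite le_eqVlt; apply/orP; left; apply/eqP.
      by field; rewrite !gt_eqF // -natrD.
    rewrite [X in _ + X]big1 ?addr0 => [|i _]; last by rewrite expr0n.
    apply: le_trans (V1 _ h1) _; rewrite le_eqVlt; apply/orP; left; apply/eqP.
    by field; rewrite !gt_eqF // -natrD.
  + rewrite big_sumType /=; case: (boolP (feval b F1)) => /= k1 k2.
      rewrite big1 ?add0r => [|i _]; last by rewrite mulr0.
      exact: E2.
    rewrite [X in _ + X]big1 ?addr0 => [|i _]; last by rewrite mulr0.
    exact: E1.
- have [J1 [l1 [u1 [v1 [c1 U1 V1 E1]]]]] := IH1 _ A0.
  have [J2 [l2 [u2 [v2 [c2 U2 V2 E2]]]]] := IH2 _ A0.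
  exists (J1 + J2)%type,
   (fun j => match j with inl j => l1 j | inr j => l2 j end),
   (fun a j => match j with inl j => if feval a F1 then u1 a j else 0
                          | inr j => if feval a F1 then 0 else u2 a j end),
   (fun a j => match j with inl j => v1 a j | inr j => v2 a j end).
  split=> [|a|a|a b].
  + by rewrite card_sum c1 c2.
  + rewrite big_sumType /=; case: (boolP (feval a F1)) => /= h1 h2.
      rewrite [X in _ + X]big1 ?addr0 => [|i _]; last by rewrite expr0n.
      exact: U1.
    rewrite big1 ?add0r => [|i _]; last by rewrite expr0n.
    exact: U2.
  + rewrite negb_or => /andP[h1 h2].
    rewrite big_sumType /= (le_trans (lerD (V1 _ h1) (V2 _ h2))) //.
    by rewrite -mulrDl -natrD.
  + rewrite negb_or big_sumType /= => + /andP[k1 k2].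
    case: (boolP (feval a F1)) => /= h1 h2.
      rewrite [X in _ + X]big1 ?addr0 => [|i _]; last by rewrite mul0r.
      exact: E1.
    rewrite big1 ?add0r => [|i _]; last by rewrite mul0r.
    exact: E2.
- have s0 : 0 < (fsize F)%:R :> R by rewrite ltr0n fsize_gt0.
  have [|J [l [u [v [c U W E]]]]] := IH ((fsize F)%:R / A).
    by rewrite divr_gt0.
  exists J, l, v, u; split=> // [a h|a|a b].
  + by apply: le_trans (W _ h) _; rewrite invf_div mulrC divfK ?gt_eqF.
  + by rewrite negbK => /U.
  + rewrite negbK => h1 h2; rewrite -(E _ _ h2 h1).
    by apply: eq_big => [j|j _]; rewrite 1?eq_sym 1?mulrC.
Qed.

Definition vec (R : realFieldType) (T : finType) (f : T -> R) : 'cV[R]_#|T| :=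
  \col_i f (enum_val i).

Lemma dot_vec (R : realFieldType) (T : finType) (f g : T -> R) :
  dot (vec f) (vec g) = \sum_t f t * g t.
Proof.
rewrite [RHS](eq_bigl (mem T)) // big_enum_val.
by apply: eq_bigr => i _; rewrite !mxE.
Qed.

Lemma sum_pair_bool (M : nmodType) (J : finType) (f : J * bool -> M) :
  \sum_p f p = \sum_j (f (j, true) + f (j, false)).
Proof.
under [RHS]eq_bigr => j _ do rewrite -(big_bool _ (fun b => f (j, b))) /=.
by rewrite pair_bigA; apply: eq_bigr => -[].
Qed.

(** The input oracle of the walk: a coordinate labelled [(v, b)] keeps its sign iff [b = a v]. If
    [a v] is a parity of the input, each diagonal entry is, up to sign, a character. *)
Definition signs (R : realFieldType) V n (d : 'I_n -> option (V * bool))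
    (a : V -> bool) : 'M[R]_n :=
  diag_mx (\row_i if d i is Some (v, b) then (-1) ^+ (b (+) a v) else 1).

Lemma signs_tr (R : realFieldType) V n d a : (@signs R V n d a)^T = signs R d a.
Proof. exact: tr_diag_mx. Qed.

Lemma signs_sqr (R : realFieldType) V n d a :
  @signs R V n d a *m signs R d a = 1%:M.
Proof.
rewrite mulmx_diag -diag_const_mx; congr diag_mx; apply/rowP => i; rewrite !mxE.
by case: (d i) => [[v b]|]; rewrite ?mulr1 // -signr_addb addbb.
Qed.

(** Coordinates are the pairs (leaf, bit) and one extra direction [e]. For true [x], [phi x] is [e]
    plus [u] placed at the bits agreeing with [x], so the oracle fixes it. For false [x], [psi x] is
    [e] minus [v] placed at the disagreeing bits, so its sum with its oracle image is [2 e]. [L]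
    negates every such [psi] and fixes their orthogonal complement. *)
Lemma formula_walk (R : rcfType) (V : Type) (X : finType) (a : X -> V -> bool)
    (F : formula V) (k : nat) :
  (0 < k)%N -> (1600 * fsize F <= k ^ 2)%N ->
  exists (n : nat) (e : 'cV[R]_n) (L : 'M[R]_n) (d : 'I_n -> option (V * bool)),
    [/\ (n <= (fsize F).*2.+1)%N, forall i, `|e i 0| <= 1,
        forall i j, `|L i j| <= 1 &
        forall x, let p := walk_mean L (signs R d (a x)) k e in
          p <= 1 /\ (if feval (a x) F then 3 / 4 <= p else p <= 1 / 8)].
Proof.
move=> k0 sk.
(* With [A = 1/16], [phi x] is within 1/4 of [e], and [psi x] has squared length at most
   [1 + 16 s <= 25 s <= (k / 8)^2]. *)
have [|J [lab [u [v [cJ U W E]]]]] := @formula_certificate R V F 16^-1.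
  by rewrite invr_gt0 ltr0n.
pose T : finType := (J * bool + unit)%type.
pose phi x (t : T) : R := match t with
  | inl (j, b) => if b == a x (lab j) then u (a x) j else 0 | inr _ => 1 end.
pose psi x (t : T) : R := match t with
  | inl (j, b) => if b == a x (lab j) then 0 else - v (a x) j | inr _ => 1 end.
pose e (t : T) : R := if t is inr _ then 1 else 0.
have [L [LT LL L0 L1]] :=
  orthogonal_reflection [seq vec (psi x) | x <- enum X & ~~ feval (a x) F].
pose d (i : 'I_#|T|) : option (V * bool) :=
  if enum_val i is inl (j, b) then Some (lab j, b) else None.
have sumT (f : T -> R) :
    \sum_t f t = \sum_j (f (inl (j, true)) + f (inl (j, false))) + f (inr tt).
  rewrite big_sumType /= sum_pair_bool; congr (_ + _).
  by rewrite (big_pred1 tt) // => -[].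
have ee : dot (vec e) (vec e) = 1.
  by rewrite dot_vec sumT big1 /= ?mulr1 ?add0r // => i _; rewrite mulr0 addr0.
exists #|T|, (vec e), L, d; split.
- by rewrite card_sum card_prod card_bool card_unit cJ muln2 addn1.
- by move=> i; rewrite mxE /e; case: (enum_val i) => _; rewrite ?normr0 ?normr1.
(* [L] is symmetric with square 1, so its columns are unit vectors. *)
- move=> i j; rewrite -[1](expr1n _ 1) -(ler_pXn2r (ltn0Sn 1)) ?nnegrE // expr1n.
  have /matrixP/(_ j j) := LL; rewrite !mxE eqxx => h.
  have Lsym l : L l j = L j l by rewrite -[in LHS]LT mxE.
  rewrite real_normK ?num_real // expr1n -[X in _ <= X]h (bigD1 i) //= Lsym -expr2.
  by rewrite lerDl; apply: sumr_ge0 => l _; rewrite Lsym -expr2 sqr_ge0.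
- move=> x p; split.
    by apply: walk_mean_le1 => //; [exact: signs_tr|exact: signs_sqr].
  have Pvec (f : T -> R) : signs R d (a x) *m vec f = vec (fun t => match t with
     inl (j, b) => if b == a x (lab j) then f t else - f t | _ => f t end).
    apply/colP => i; rewrite mul_diag_mx !mxE /d.
    case: (enum_val i) => [[j b]|[]]; last by rewrite mul1r.
    by rewrite -negb_eqb; case: (b == _) => /=; rewrite ?mul1r ?mulN1r.
  case: ifP => hx.
  + rewrite [X in X <= _](_ : _ = 1 - 1 / 4); last by field.
    apply: (@walk_mean_fixed _ _ _ _ LT LL (signs_tr _ _ _) (signs_sqr _ _ _)
              _ _ _ (vec (phi x))) => //; last 1 first.
    * rewrite (_ : vec _ - vec _ = vec (fun t => phi x t - e t)); last first.
        by apply/colP => i; rewrite !mxE.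
      rewrite dot_vec sumT /= subrr mulr0 addr0.
      rewrite (_ : (1 / 4) ^+ 2 = 16^-1); last by field.
      apply: le_trans (U _ hx); apply: ler_sum => j _; rewrite !subr0.
      by case: (a x (lab j)); rewrite /= mulr0 ?addr0 ?add0r expr2.
    * by rewrite dot_vec sumT big1 /= ?mulr1 ?add0r // => i _; rewrite !mul0r addr0.
    * rewrite Pvec; apply/colP => i; rewrite !mxE /=.
      by case: (enum_val i) => [[j b]|[]] //=; case: eqP => // _; rewrite oppr0.
    (* [phi x] is orthogonal to each [psi y]: the extra coordinate contributes 1, and the leaves
       where [x] and [y] differ contribute minus the certificate sum, which is 1. *)
    * apply: L1 => w /mapP[y]; rewrite mem_filter => /andP[hy _] ->.
      rewrite dot_vec sumT /= mulr1 -(E _ _ hx hy) [X in _ + X]big_mkcond -big_split /=.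
      apply: big1 => j _.
      case: (a x (lab j)); case: (a y (lab j));
        rewrite /= ?mulr0 ?mul0r ?addr0 ?add0r ?mulNr //; apply/eqP;
        by rewrite addrC subr_eq0 mulrC.
    * by rewrite divr_ge0.
  + rewrite [X in _ <= X](_ : _ = k%:R / 8 / k%:R); last first.
      by field; rewrite pnatr_eq0 -lt0n.
    have hx' : ~~ feval (a x) F by rewrite hx.
    apply: (@walk_mean_moved _ _ _ _ LT LL (signs_tr _ _ _) (signs_sqr _ _ _)
              _ _ _ (vec (psi x))) => //.
    * rewrite Pvec; apply/colP => i; rewrite !mxE /=.
      case: (enum_val i) => [[j b]|[]] //=.
      by case: eqP => // _; rewrite ?addr0 ?subrr ?opprK ?addNr ?addr0.
    * by apply: L0; apply/mapP; exists x; rewrite // mem_filter hx' mem_enum.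
    * by rewrite divr_ge0.
    * rewrite dot_vec sumT /= mulr1.
      have s1 : 1 <= (fsize F)%:R :> R by rewrite ler1n fsize_gt0.
      have : (1600 * fsize F)%:R <= (k ^ 2)%:R :> R by rewrite ler_nat.
      rewrite natrM natrX => sk'.
      have := W _ hx'; rewrite invrK => Wx.
      have -> : \sum_j ((if true == a x (lab j) then 0 else - v (a x) j) *
                  (if true == a x (lab j) then 0 else - v (a x) j) +
                  (if false == a x (lab j) then 0 else - v (a x) j) *
                  (if false == a x (lab j) then 0 else - v (a x) j)) =
                \sum_j v (a x) j ^+ 2.
        apply: eq_bigr => j _.
        by case: (a x (lab j)); rewrite /= mulr0 ?addr0 ?add0r mulrNN expr2.
      rewrite expr_div_n; lra.
Qed.

(** * Fooling parities of formulas *)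

Definition mean (R : realFieldType) (Z : finType) (f : Z -> R) : R :=
  (\sum_z f z) / #|Z|%:R.

Lemma mean_sum (R : realFieldType) (Z I : finType) (f : I -> Z -> R) :
  mean (fun z => \sum_i f i z) = \sum_i mean (f i).
Proof. by rewrite /mean exchange_big -mulr_suml. Qed.

Lemma meanZ (R : realFieldType) (Z : finType) c (f : Z -> R) :
  mean (fun z => c * f z) = c * mean f.
Proof. by rewrite /mean -mulr_sumr mulrA. Qed.

Lemma meanD (R : realFieldType) (Z : finType) (f g : Z -> R) :
  mean (fun z => f z + g z) = mean f + mean g.
Proof. by rewrite /mean big_split mulrDl. Qed.

Lemma mean_cst (R : realFieldType) (Z : finType) (c : R) :
  (0 < #|Z|)%N -> mean (fun _ : Z => c) = c.
Proof.
by move=> Z0; rewrite /mean sumr_const -[c *+ _]mulr_natr mulfK // pnatr_eq0 -lt0n.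
Qed.

Lemma le_mean (R : realFieldType) (Z : finType) (f g : Z -> R) :
  (forall z, f z <= g z) -> mean f <= mean g.
Proof. by move=> fg; rewrite ler_wpM2r ?invr_ge0 // ler_sum. Qed.

Lemma eq_mean (R : realFieldType) (Z : finType) (f g : Z -> R) :
  f =1 g -> mean f = mean g.
Proof. by move=> fg; congr (_ / _); apply: eq_bigr. Qed.

Section Fooling.
Variables (R : rcfType) (N : nat).

Definition chi (S : {set 'I_N}) (x : N.-tuple bool) : R :=
  (-1) ^+ parity (S, false) x.

Lemma chiM S1 S2 x :
  chi S1 x * chi S2 x = chi ((S1 :\: S2) :|: (S2 :\: S1)) x.
Proof.
rewrite -signr_addb /parity /=; congr (_ ^+ nat_of_bool _).
rewrite big_mkcond [X in _ (+) X]big_mkcond [RHS]big_mkcond -big_split.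
apply: eq_bigr => i _; rewrite !inE.
by case: (i \in S1); case: (i \in S2); rewrite /= ?addbb ?addbF ?addFb.
Qed.

Variables (Z U : finType) (xz : Z -> N.-tuple bool) (xu : U -> N.-tuple bool).

(* Closed under multiplication by characters, unlike the bare difference of
   the two means of f. *)
Definition fooled (B : R) (f : N.-tuple bool -> R) :=
  forall S, `|mean (fun z => chi S (xz z) * f (xz z)) -
              mean (fun u => chi S (xu u) * f (xu u))| <= B.

Lemma fooled_ext B f g : f =1 g -> fooled B f -> fooled B g.
Proof.
move=> fg fB S; have := fB S.
have eqm (W : finType) (w : W -> N.-tuple bool) :
    mean (fun z => chi S (w z) * f (w z)) = mean (fun z => chi S (w z) * g (w z)).
  by apply: eq_mean => z; rewrite fg.
by rewrite !eqm.
Qed.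

Lemma fooled_chi B f S : fooled B f -> fooled B (fun x => chi S x * f x).
Proof.
move=> fB S'; have := fB ((S' :\: S) :|: (S :\: S')).
under eq_mean => z do rewrite -chiM -mulrA.
by under [X in _ - X]eq_mean => z do rewrite -chiM -mulrA.
Qed.

Lemma fooled_scale B c f :
  fooled B f -> fooled (`|c| * B) (fun x => c * f x).
Proof.
move=> fB S; under eq_mean => z do rewrite mulrCA.
under [X in _ - X]eq_mean => z do rewrite mulrCA.
by rewrite !meanZ -mulrBr normrM ler_wpM2l.
Qed.

Lemma fooled_le B B' f : B <= B' -> fooled B f -> fooled B' f.
Proof. by move=> BB fB S; apply: le_trans (fB S) BB. Qed.

Lemma fooled_ge0 B f : fooled B f -> 0 <= B.
Proof. by move=> /(_ set0); apply: le_trans. Qed.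

Lemma fooled_shrink B c f :
  `|c| <= 1 -> fooled B f -> fooled B (fun x => c * f x).
Proof.
move=> c1 fB; apply: fooled_le (fooled_scale c fB).
by rewrite ler_piMl ?(fooled_ge0 fB).
Qed.

Lemma fooled_sum n B (f : 'I_n -> N.-tuple bool -> R) :
  (forall i, fooled B (f i)) -> fooled (n%:R * B) (fun x => \sum_i f i x).
Proof.
move=> fB S.
under eq_mean => z do rewrite mulr_sumr.
under [X in _ - X]eq_mean => z do rewrite mulr_sumr.
rewrite !mean_sum -sumrB; apply: le_trans (ler_norm_sum _ _ _) _.
rewrite mulr_natl -[n in X in _ <= X]card_ord -sumr_const.
by apply: ler_sum => i _; apply: fB.
Qed.

(** The oracle multiplies each coordinate by a signed character or by 1, which costs nothing; a row
    of [L] then sums [n] terms with coefficients of size at most 1, which costs a factor [n]. *)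
Lemma fooled_walk n (L : 'M[R]_n) (e : 'cV[R]_n) s (g : 'I_s -> {set 'I_N} * bool)
    (d : 'I_n -> option ('I_s * bool)) eps j i :
  (forall i j, `|L i j| <= 1) -> (forall i, `|e i 0| <= 1) ->
  fooled eps (fun=> 1) ->
  fooled (n%:R ^+ j * eps)
    (fun x => walk L (signs R d (fun v => parity (g v) x)) j e i 0).
Proof.
move=> L1 e1 E; elim: j i => [|j IH] i /=.
  rewrite mul1r; apply: fooled_ext (fooled_shrink (e1 i) E) => x.
  by rewrite mulr1.
rewrite exprS -mulrA; apply: (fooled_ext (f := fun x => \sum_l
  L i l * (signs R d (fun v => parity (g v) x) *m
           walk L (signs R d (fun v => parity (g v) x)) j e) l 0)).
  by move=> x; rewrite mxE.
apply: fooled_sum => l; apply: fooled_shrink => //.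
case dl: (d l) => [[v b]|]; last first.
  by apply: fooled_ext (IH l) => x; rewrite mul_diag_mx !mxE dl mul1r.
have c1 : `|(-1) ^+ (b (+) (g v).2) : R| <= 1 by rewrite normr_sign.
apply: fooled_ext (fooled_shrink c1 (fooled_chi (g v).1 (IH l))) => x.
by rewrite mul_diag_mx !mxE dl mulrA /chi -signr_addb /parity /= -addbA.
Qed.

(** The walk mean [p] is at least 3/4 on every [xz z], so it averages at least 3/4 - 1/8 over the
    [xu u]; pointwise [p <= h + 1/8], which leaves 1/2 for [h]. *)
Lemma formula_xor_fooled s k h eps :
  in_FORMULA_XOR s h -> (0 < k)%N -> (1600 * s <= k ^ 2)%N ->
  (0 < #|Z|)%N -> (0 < #|U|)%N ->
  fooled eps (fun=> 1) -> eps * (s.*2.+1)%:R ^+ k <= 1 / 8 ->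
  (forall z, h (xz z)) -> 1 / 2 <= mean (fun u => (h (xu u))%:R) :> R.
Proof.
move=> [F [g [Fs Fg]]] k0 sk Z0 U0 fE epsk hz.
have [|n [e [L [d [nF e1 L1 W]]]]] :=
  @formula_walk R _ {: N.-tuple bool} (fun x v => parity (g v) x) F k k0.
  by apply: leq_trans sk; rewrite leq_mul2l Fs orbT.
pose p x := walk_mean L (signs R d (fun v => parity (g v) x)) k e.
have eps0 := fooled_ge0 fE.
have fp : fooled (1 / 8) p.
  pose f (j : 'I_k) x := dot e (walk L (signs R d (fun v => parity (g v) x)) j e).
  have fB j : fooled (1 / 8) (f j).
    (* The product with [e] costs one more factor [n]; since [j < k], the total [n^(j+1)] is at most
       [(2 s + 1)^k]. *)
    apply: (@fooled_le (n%:R * (n%:R ^+ j * eps))).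
      apply: le_trans epsk; rewrite mulrA -exprS mulrC ler_wpM2l //.
      have ns : (n <= s.*2.+1)%N by rewrite (leq_trans nF) // ltnS leq_double.
      rewrite -!natrX ler_nat (leq_trans (n := (s.*2.+1) ^ j.+1)%N) ?leq_exp2r //.
      by rewrite leq_pexp2l.
    by apply: fooled_sum => i; apply: fooled_shrink => //; apply: fooled_walk.
  apply: (fooled_ext (f := fun x => k%:R^-1 * \sum_j f j x)).
    by move=> x; rewrite mulrC.
  apply: (@fooled_le (`|k%:R^-1| * (k%:R * (1 / 8)))).
    by rewrite ger0_norm ?invr_ge0 // mulKf // pnatr_eq0 -lt0n.
  by apply: fooled_scale; apply: fooled_sum.
have chi0 x : chi set0 x = 1 by rewrite /chi /parity big_set0.
have := fp set0; under eq_mean => z do rewrite chi0 mul1r.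
under [X in _ - X]eq_mean => u do rewrite chi0 mul1r.
have pz : 3 / 4 <= mean (fun z => p (xz z)).
  rewrite -(mean_cst (3 / 4) Z0); apply: le_mean => z.
  by have [_] := W (xz z); rewrite Fg hz.
have pu : mean (fun u => p (xu u)) <= mean (fun u => (h (xu u))%:R) + 1 / 8.
  rewrite -[X in _ + X](mean_cst _ U0) -meanD; apply: le_mean => u.
  have [p1] := W (xu u); rewrite Fg /p; case: (h _) => p2 /=; last by rewrite add0r.
  by apply: le_trans p1 _; lra.
rewrite ler_norml => /andP[_]. lra.
Qed.

End Fooling.

(** * The small-bias generator *)

Lemma mean_pair (R : realFieldType) (A B : finType) (f : A * B -> R) :
  mean f = mean (fun a => mean (fun b => f (a, b))).
Proof.
rewrite /mean -mulr_suml card_prod natrM invfM mulrA mulrAC.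
by rewrite pair_bigA /=; congr (_ / _ / _); apply: eq_bigr => -[].
Qed.

Lemma mean_bool (R : realFieldType) (f : bool -> R) :
  mean f = (f true + f false) / 2.
Proof. by rewrite /mean big_bool card_bool. Qed.

Lemma mean_ffun (R : realFieldType) (I J : finType) (F : I -> J -> R) :
  mean (fun f : {ffun I -> J} => \prod_i F i (f i)) = \prod_i mean (F i).
Proof.
rewrite /mean big_split /= -bigA_distr_bigA prodr_const exprVn.
by rewrite card_ffun natrX.
Qed.

Section Isolation.
Variables (R : realFieldType) (m : nat) (I : finType) (y : I -> m.-tuple bool).
Hypothesis y_inj : injective y.

Definition sgn (T : {set I}) (f : I -> bool) : R := \prod_(i in T) (-1) ^+ f i.

Lemma sgnE (T : {set I}) (f : I -> bool) :
  (-1) ^+ (\big[addb/false]_(i in T) f i) = sgn T f.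
Proof.
by apply: (big_morph (fun b : bool => (-1) ^+ b : R)) => // a b; rewrite signr_addb.
Qed.

Lemma mean_parity (x : m.-tuple bool) :
  mean (fun g : {set 'I_m} * bool => (-1) ^+ parity g x) = 0 :> R.
Proof.
rewrite mean_pair /mean big1 ?mul0r // => S _.
by rewrite big_bool /parity /= signrN addrC subrr mul0r.
Qed.

(** The negation bits cancel, and the sum over [S] factors over coordinates as a product of terms
    [1 + G i]; one where [x] and [x'] differ gives [1 - 1 = 0]. *)
Lemma mean_parity2 (x x' : m.-tuple bool) : x != x' ->
  mean (fun g : {set 'I_m} * bool => (-1) ^+ parity g x * (-1) ^+ parity g x') = 0 :> R.
Proof.
move=> xx; have [i0 hi0] : exists i, tnth x i != tnth x' i.
  apply/existsP; rewrite -negb_forall; apply: contra xx => /forallP h.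
  by apply/eqP/eq_from_tnth => i; apply/eqP.
rewrite mean_pair; pose G i : R := (-1) ^+ (tnth x i (+) tnth x' i).
under eq_mean => S.
  under eq_mean => b.
    rewrite -signr_addb /parity /= addbACA addbb addFb -big_split /=.
    rewrite (big_morph (fun b : bool => (-1) ^+ b : R) (id1 := 1) (op1 := *%R)) //;
      last by move=> u v; rewrite signr_addb.
    rewrite big_mkcond.
    over.
  rewrite mean_cst ?card_bool //.
  over.
rewrite /mean (_ : \sum_z _ = \prod_i (G i + 1)).
  rewrite (bigD1 i0) //= /G.
  have -> : tnth x i0 (+) tnth x' i0 = true by rewrite -negb_eqb.
  by rewrite expr1 addNr !mul0r.
by rewrite bigA_distr; apply: eq_big => // S; rewrite inE.
Qed.

(** Membership in the affine subspace cut out by the first [k] rows. All [m + 2] rows are always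
    drawn, so that [k] can itself be random. *)
Definition hash (k : nat) (rows : {ffun 'I_m.+2 -> {set 'I_m} * bool}) (i : I) :=
  [forall a : 'I_m.+2, (a < k)%N ==> ~~ parity (rows a) (y i)].

Lemma natr_neg (b : bool) : (~~ b)%:R = (1 + (-1) ^+ b) / 2 :> R.
Proof. by case: b; rewrite /= ?expr1 ?expr0; field. Qed.

Lemma hashE k rows i :
  (hash k rows i)%:R =
    \prod_(a < m.+2) (if (a < k)%N then (~~ parity (rows a) (y i))%:R else 1) :> R.
Proof.
case: (boolP (hash _ _ _)) => [/forallP h|].
  by rewrite big1 // => a _; move: (h a); case: ltnP => //= _ ->.
rewrite negb_forall => /existsP[a]; rewrite negb_imply => /andP[ak h].
by rewrite (bigD1 a) //= ak (negbTE h) mul0r.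
Qed.

Lemma prod_lt (c : R) k : (k <= m.+2)%N ->
  \prod_(a < m.+2) (if (a < k)%N then c else 1) = c ^+ k.
Proof.
by move=> km; rewrite -big_mkcond /= -(big_ord_widen _ (fun=> c)) // prodr_const card_ord.
Qed.

Lemma mean_hash k i : (k <= m.+2)%N ->
  mean (fun rows => (hash k rows i)%:R) = 2^-1 ^+ k :> R.
Proof.
move=> km; under eq_mean => rows do rewrite hashE.
rewrite (mean_ffun (fun (a : 'I_m.+2) (g : {set 'I_m} * bool) =>
  if (a < k)%N then (~~ parity g (y i))%:R else 1)).
rewrite -prod_lt //; apply: eq_bigr => a _; case: ifP => _.
  under eq_mean => g do rewrite natr_neg mulrC.
  rewrite meanZ meanD mean_parity mean_cst ?addr0 ?mulr1 //.
  by rewrite card_prod card_bool muln_gt0 andbT; apply/card_gt0P; exists set0.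
by rewrite mean_cst //; apply/card_gt0P; exists (set0, true).
Qed.

(** Pairwise independence of random affine forms: in the expansion of the two indicators into signs,
    every nonconstant term averages to 0. *)
Lemma mean_hash2 k i j : (k <= m.+2)%N -> i != j ->
  mean (fun rows => (hash k rows i)%:R * (hash k rows j)%:R) = 4^-1 ^+ k :> R.
Proof.
move=> km ij; under eq_mean => rows do rewrite !hashE -big_split /=.
rewrite (mean_ffun (fun (a : 'I_m.+2) (g : {set 'I_m} * bool) =>
   (if (a < k)%N then (~~ parity g (y i))%:R else 1) *
   (if (a < k)%N then (~~ parity g (y j))%:R else 1))).
have c0 : (0 < #|{: {set 'I_m} * bool}|)%N by apply/card_gt0P; exists (set0, true).
rewrite -prod_lt //; apply: eq_bigr => a _; case: ifP => _.
  have E g : (~~ parity g (y i))%:R * (~~ parity g (y j))%:R =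
    4^-1 * (1 + (-1) ^+ parity g (y i) + (-1) ^+ parity g (y j) +
            (-1) ^+ parity g (y i) * (-1) ^+ parity g (y j)) :> R.
    by rewrite !natr_neg; field.
  under eq_mean => g do rewrite E.
  rewrite meanZ !meanD mean_parity2 ?(inj_eq y_inj) // !mean_parity mean_cst //.
  by rewrite !addr0 mulr1.
by rewrite mulr1 mean_cst.
Qed.

(* Valiant-Vazirani isolation, through the inequality [X odd] >= 2 X - X^2 *)
Lemma odd_hash k (T : {set I}) : (k <= m.+2)%N ->
  #|T|%:R / 2 ^+ k - (#|T|%:R / 2 ^+ k) ^+ 2 <=
    mean (fun rows => (odd (\sum_(i in T) hash k rows i))%:R) :> R.
Proof.
move=> km; set mu : R := _ / _.
have le X : 2 * X%:R - X%:R ^+ 2 <= (odd X)%:R :> R.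
  case: X => [|[|X]]; [by rewrite expr0n mulr0 subr0|by rewrite expr1n /=; lra|].
  apply: le_trans (ler0n _ _); have : 2 <= X.+2%:R :> R by rewrite ler_nat.
  move=> h; rewrite expr2 -mulrBl; apply: mulr_le0_ge0 => //; lra.
apply: le_trans (le_mean (fun rows => le (\sum_(i in T) hash k rows i)%N)).
have E rows : (2 * (\sum_(i in T) hash k rows i)%:R - (\sum_(i in T) hash k rows i)%:R ^+ 2 : R) =
   2 * (\sum_i (i \in T)%:R * (hash k rows i)%:R) +
   - 1 * (\sum_i \sum_j (i \in T)%:R * (j \in T)%:R * ((hash k rows i)%:R * (hash k rows j)%:R)).
  have -> : ((\sum_(i in T) hash k rows i)%:R : R) = \sum_i (i \in T)%:R * (hash k rows i)%:R.
    rewrite natr_sum big_mkcond; apply: eq_bigr => i _.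
    by case: ifP => _; rewrite ?mul1r ?mul0r.
  rewrite mulN1r; congr (_ - _); rewrite expr2 mulr_suml; apply: eq_bigr => i _.
  by rewrite mulr_sumr; apply: eq_bigr => j _; ring.
under eq_mean => rows do rewrite E.
rewrite meanD !meanZ !mean_sum.
have cT : \sum_i (i \in T)%:R = #|T|%:R :> R.
  by rewrite -sum1_card natr_sum [RHS]big_mkcond; apply: eq_bigr => i _; case: ifP.
have -> : \sum_i mean (fun rows => (i \in T)%:R * (hash k rows i)%:R) = mu :> R.
  under eq_bigr => i _ do rewrite meanZ mean_hash //.
  by rewrite -mulr_suml cT exprVn.
(* Second moment: the diagonal gives [mu], the off-diagonal pairs at most [mu^2]. Hence
   [2 mu - (mu + mu^2)] in the end. *)
have : \sum_i mean (fun rows => \sum_j (i \in T)%:R * (j \in T)%:R *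
          ((hash k rows i)%:R * (hash k rows j)%:R)) <= mu + mu ^+ 2 :> R.
  under eq_bigr => i _ do rewrite mean_sum.
  apply: le_trans (_ : \sum_i \sum_j
      ((i \in T)%:R * (if j == i then 2^-1 ^+ k else 0) +
       (i \in T)%:R * (j \in T)%:R * 4^-1 ^+ k) <= _).
    apply: ler_sum => i _; apply: ler_sum => j _; rewrite meanZ.
    have [->|ij] := eqVneq j i; last by rewrite mean_hash2 1?eq_sym // mulr0 add0r.
    under eq_mean => rows do rewrite -natrM mulnb andbb.
    rewrite mean_hash // -natrM mulnb andbb lerDl.
    by rewrite mulr_ge0 ?exprn_ge0 ?invr_ge0.
  under eq_bigr => i _ do rewrite big_split /= -!mulr_sumr -big_mkcond /= big_pred1_eq.
  rewrite big_split /= -!mulr_suml cT exprVn lerD2l.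
  under eq_bigr => i _ do rewrite -mulr_suml -mulr_sumr cT.
  rewrite -!mulr_suml cT le_eqVlt; apply/orP; left; apply/eqP.
  by rewrite /mu expr_div_n -exprM mulnC exprM exprVn (_ : 2 ^+ 2 = 4); [ring|ring].
lra.
Qed.

Lemma sgn_nat (T : {set I}) (f : I -> bool) :
  sgn T f = 1 - 2 * (odd (\sum_(i in T) f i))%:R.
Proof.
rewrite /sgn prodrXr -signr_odd.
by case: odd; rewrite /= ?expr1 ?expr0; ring.
Qed.

Definition seed := ('I_m.+3 * {ffun 'I_m.+2 -> {set 'I_m} * bool} * bool)%type.

(** The random bit turns the mean sign into one minus the probability of odd intersection with [T],
    which is never negative. *)
Definition base (z : seed) (i : I) := z.2 && hash z.1.1 z.1.2 i.

(** If [2^e <= #|T| < 2^(e+1)], the value [k = e + 2] puts [mu] between 1/4 and 1/2, where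
    [mu - mu^2] exceeds 1/8; this [k] has probability [1 / (m + 3)]. As [#|T| <= 2^m], [m + 2] rows
    suffice. *)
Lemma mean_base (T : {set I}) : T != set0 ->
  0 <= mean (fun z => sgn T (base z)) <= 1 - (8 * m.+3)%:R^-1.
Proof.
move=> T0; have {}T0 : (0 < #|T|)%N by rewrite card_gt0.
pose q k := mean (fun rows => (odd (\sum_(i in T) hash k rows i))%:R) : R.
have c0 : (0 < #|{: {set 'I_m} * bool}|)%N by apply/card_gt0P; exists (set0, true).
have cr : (0 < #|{: {ffun 'I_m.+2 -> {set 'I_m} * bool}}|)%N by rewrite card_ffun expn_gt0 c0.
have q01 k : 0 <= q k <= 1.
  rewrite divr_ge0 ?sumr_ge0 //= -(mean_cst 1 cr); apply: le_mean => rows.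
  by case: odd.
have -> : mean (fun z => sgn T (base z)) = 1 - mean (fun k : 'I_m.+3 => q k).
  have E z : mean (fun b => sgn T (base (z, b))) =
             1 + - 1 * (odd (\sum_(i in T) hash z.1 z.2 i))%:R.
    have z0 : (\sum_(i in T) base (z, false) i)%N = 0%N by rewrite big1.
    by rewrite mean_bool !sgn_nat z0 /=; field.
  rewrite mean_pair (eq_mean E) meanD meanZ mean_cst ?card_prod ?card_ord ?muln_gt0 //.
  by rewrite mulN1r mean_pair.
have I3 : (0 < #|'I_m.+3|)%N by rewrite card_ord.
have m1 : mean (fun k : 'I_m.+3 => q k) <= 1.
  by rewrite -[X in _ <= X](mean_cst _ I3); apply: le_mean => k; case/andP: (q01 k).
rewrite subr_ge0 m1 lerD2l lerN2 /=.
have /andP[l1 l2] := trunc_log_bounds (isT : (1 < 2)%N) T0.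
set e := trunc_log 2 #|T| in l1 l2.
have Tm : (#|T| <= 2 ^ m)%N.
  apply: leq_trans (max_card _) _; rewrite (leq_trans (leq_card _ y_inj)) //.
  by rewrite card_tuple card_bool.
have em : (e.+2 <= m.+2)%N by rewrite !ltnS -(leq_exp2l (m := 2)) // (leq_trans l1).
have eo : (e.+2 < m.+3)%N by [].
rewrite /mean card_ord natrM invfM (bigD1 (Ordinal eo)) //= ler_wpM2r ?invr_ge0 //.
apply: le_trans (_ : q e.+2 <= _); last first.
  by rewrite lerDl sumr_ge0 // => k _; case/andP: (q01 k).
apply: le_trans (odd_hash T em).
set mu : R := _ / _.
have p0 : 0 < 2 ^+ e.+2 :> R by rewrite exprn_gt0.
have pe : 2 ^+ e.+2 = 4 * 2 ^+ e :> R by rewrite !exprS; ring.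
have r1 : 2 ^+ e <= #|T|%:R :> R by rewrite -natrX ler_nat.
have r2 : #|T|%:R <= 2 * 2 ^+ e :> R by rewrite -exprS -natrX ler_nat ltnW.
have mu1 : 1 / 4 <= mu by rewrite ler_pdivlMr // pe; lra.
have mu2 : mu <= 1 / 2 by rewrite ler_pdivrMr // pe; lra.
nra.
Qed.

Definition gen t (z : {ffun 'I_t -> seed}) (i : I) :=
  \big[addb/false]_(j < t) base (z j) i.

Lemma mean_gen t (T : {set I}) :
  mean (fun z : {ffun 'I_t -> seed} => sgn T (gen z)) = mean (fun z => sgn T (base z)) ^+ t.
Proof.
rewrite -[in RHS](card_ord t) -prodr_const -mean_ffun; apply: eq_mean => z.
rewrite /sgn exchange_big /=; apply: eq_bigr => i _; rewrite /gen.
by apply: (big_morph (fun b : bool => (-1) ^+ b : R)) => // a b; rewrite signr_addb.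
Qed.

Lemma mean_sgn (T : {set I}) : T != set0 ->
  mean (fun u : {ffun I -> bool} => sgn T u) = 0.
Proof.
case/set0Pn => i0 iT.
under eq_mean => u do rewrite /sgn big_mkcond /=.
rewrite (mean_ffun (fun i (b : bool) => if i \in T then (-1) ^+ b else 1)).
by rewrite (bigD1 i0) //= iT mean_bool expr1 expr0 addNr !mul0r.
Qed.

End Isolation.

(** * MCSP inputs with a fixed size parameter, and their characters *)

Lemma bits_inj m i j : (i < 2 ^ m)%N -> (j < 2 ^ m)%N -> bits m i = bits m j -> i = j.
Proof.
elim: m i j => [|m IH] i j; first by rewrite !ltnS !leqn0 => /eqP-> /eqP->.
move=> im jm [] /eqP; rewrite !divn1 => /eqP ij h.
rewrite -[i]odd_double_half -[j]odd_double_half ij; congr (_ + _.*2)%N.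
apply: IH; rewrite -?divn2 ?ltn_divLR -?expnSr //.
have e x : bits m (x %/ 2) = [seq odd (x %/ 2 ^ a) | a <- iota 1 m].
  rewrite /bits -[1%N]addn0 iotaDl -map_comp; apply: eq_map => a /=.
  by rewrite -divnMA expnS.
by rewrite !e.
Qed.

Definition bit_tuple m (i : 'I_(2 ^ m)) : m.-tuple bool :=
  [tuple odd (i %/ 2 ^ j) | j < m].

Lemma bit_tuple_bits m (i : 'I_(2 ^ m)) : bit_tuple i = bits m i :> seq bool.
Proof.
apply: (@eq_from_nth _ false) => [|a]; first by rewrite size_tuple size_map size_iota.
rewrite size_tuple => am; rewrite -(tnth_nth _ _ (Ordinal am)) tnth_mktuple.
by rewrite (nth_map 0%N) ?size_iota // nth_iota.
Qed.

Lemma bit_tuple_inj m : injective (@bit_tuple m).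
Proof.
move=> i j /(congr1 (@tval _ _)); rewrite !bit_tuple_bits => h.
by apply/val_inj/(bits_inj _ _ h).
Qed.

Definition truth_table m (f : 'I_(2 ^ m) -> bool) := [seq f i | i <- enum 'I_(2 ^ m)].

Lemma size_truth_table m f : size (@truth_table m f) = (2 ^ m)%N.
Proof. by rewrite size_map size_enum_ord. Qed.

Lemma nth_truth_table m f (i : 'I_(2 ^ m)) : nth false (truth_table f) i = f i.
Proof. by rewrite (nth_map i) ?size_enum_ord // nth_ord_enum. Qed.

Definition mcsp_input m l (f : 'I_(2 ^ m) -> bool) : (2 ^ m.+1).-tuple bool :=
  [tuple nth false (truth_table f ++ nseq l true ++ nseq (2 ^ m - l) false) i
     | i < 2 ^ m.+1].

Lemma mcsp_inputE m l f : (l <= 2 ^ m)%N ->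
  @mcsp_input m l f = truth_table f ++ nseq l true ++ nseq (2 ^ m - l) false :> seq bool.
Proof.
move=> lm; apply: (@eq_from_nth _ false) => [|i].
  by rewrite size_tuple !size_cat size_truth_table !size_nseq subnKC // addnn -mul2n expnS.
rewrite size_tuple => im; rewrite -(tnth_nth _ _ (Ordinal im)) tnth_mktuple //.
Qed.

(** The second half of the input is the same for all [f], so it contributes only a sign; the rest is
    a character of the truth table. *)
Lemma chi_mcsp_input (R : rcfType) m l (S : {set 'I_(2 ^ m.+1)}) :
  exists (c : bool) (T : {set 'I_(2 ^ m)}), forall f,
    chi R S (mcsp_input l f) = (-1) ^+ c * sgn R T f.
Proof.
have le : (2 ^ m <= 2 ^ m.+1)%N by rewrite leq_pexp2l.
pose w := widen_ord le.
exists (\big[addb/false]_(i in S | (2 ^ m <= i)%N) nth false (nseq l true) (i - 2 ^ m)).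
exists [set i | w i \in S] => f.
rewrite -sgnE -signr_addb /chi /parity /=; congr (_ ^+ nat_of_bool _).
rewrite (bigID (fun i : 'I__ => 2 ^ m <= i)%N) /=; congr (_ (+) _).
  apply: eq_bigr => i /andP[_ im].
  rewrite tnth_mktuple nth_cat size_truth_table ltnNge im /= nth_cat size_nseq.
  by case: ltnP => h; rewrite nth_nseq ?h // nth_nseq if_same ltnNge h.
(* [insubd] inverts the widening [w]; its default, index 0, is reached only from the second half,
   which the range condition excludes. *)
rewrite (reindex_onto w
  (fun i => insubd (Ordinal (expn_gt0 2 m : 0 < 2 ^ m)%N) (val i))) /=; last first.
  move=> i /andP[_]; rewrite -ltnNge => im; apply: val_inj.
  by rewrite /= val_insubd im.
apply: eq_big => [i|i _]; last first.
  by rewrite tnth_mktuple nth_cat size_truth_table /= ltn_ord nth_truth_table.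
rewrite inE -ltnNge /= ltn_ord andbT -[RHS]andbT; congr (_ && _).
by apply/eqP/val_inj; rewrite val_insubd /= ltn_ord.
Qed.

(** For empty [T] both means agree. Otherwise the uniform mean is 0 and the generator has the [t]-th
    power of the bias of one copy. *)
Lemma gen_fools (R : rcfType) m l t :
  fooled (fun z : {ffun 'I_t -> seed m} => mcsp_input l (gen (@bit_tuple m) z))
    (fun u : {ffun 'I_(2 ^ m) -> bool} => mcsp_input l u)
    ((1 - (8 * m.+3)%:R^-1) ^+ t) (fun=> 1 : R).
Proof.
move=> S; have [c [T E]] := chi_mcsp_input R l S.
under eq_mean => z do rewrite E mulr1.
under [X in _ - X]eq_mean => z do rewrite E mulr1.
rewrite !meanZ -mulrBr normrMsign mean_gen.
have d0 : 0 <= 1 - (8 * m.+3)%:R^-1 :> R.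
  by rewrite subr_ge0 invf_le1 ?ltr0n // ler1n.
have [->|T0] := eqVneq T set0.
  rewrite (eq_mean (g := fun=> 1)) => [|z]; last by rewrite /sgn big_set0.
  rewrite [X in _ - X](eq_mean (g := fun=> 1)) => [|z]; last by rewrite /sgn big_set0.
  rewrite !mean_cst ?expr1n ?subrr ?normr0 ?exprn_ge0 //.
    by rewrite card_ffun card_bool expn_gt0.
  apply/card_gt0P; exists (ord0, [ffun=> (set0, true)], true) => //.
rewrite mean_sgn // subr0.
have /andP[b0 b1] := mean_base R (@bit_tuple_inj m) T0.
by rewrite ger0_norm ?exprn_ge0 // lerXn2r ?nnegrE.
Qed.

(** * Circuits *)

Local Open Scope nat_scope.

Lemma eval_gates_cat vals gs1 gs2 :
  eval_gates vals (gs1 ++ gs2) = eval_gates (eval_gates vals gs1) gs2.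
Proof. by elim: gs1 vals => /=. Qed.

Lemma size_eval_gates vals gs : size (eval_gates vals gs) = size vals + size gs.
Proof.
by elim: gs vals => [|g gs IH] vals /=; rewrite ?addn0 // IH size_rcons addSnnS.
Qed.

Lemma nth_eval_gates vals gs i :
  i < size vals -> nth false (eval_gates vals gs) i = nth false vals i.
Proof.
elim: gs vals => //= g gs IH vals h.
by rewrite IH ?size_rcons ?ltnS 1?ltnW // nth_rcons h.
Qed.

Lemma wf_gates_cat k gs1 gs2 :
  wf_gates k (gs1 ++ gs2) = wf_gates k gs1 && wf_gates (k + size gs1) gs2.
Proof. by elim: gs1 k => [|g gs IH] k /=; rewrite ?addn0 // IH addSnnS andbA. Qed.

(* A circuit computing f can be appended to any circuit with at least m wires. *)
Definition computes m (f : 'I_(2 ^ m) -> bool) c := forall k, m <= k ->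
  exists gs out, [/\ wf_gates k gs, out < k + size gs, size gs <= c &
    forall (i : 'I_(2 ^ m)) vals, size vals = k -> take m vals = bits m i ->
      nth false (eval_gates vals gs) out = f i].

Section Computes.
Variable m : nat.
Implicit Types f : 'I_(2 ^ m) -> bool.

Lemma computes_le f c c' : c <= c' -> computes f c -> computes f c'.
Proof.
move=> cc fc k mk; have [gs [o [h1 h2 h3 h4]]] := fc k mk.
by exists gs, o; split=> //; apply: leq_trans cc.
Qed.

Lemma computes_ext f g c : f =1 g -> computes f c -> computes g c.
Proof.
move=> fg fc k mk; have [gs [o [h1 h2 h3 h4]]] := fc k mk.
by exists gs, o; split=> // i vals vk vm; rewrite (h4 _ _ vk vm).
Qed.

Lemma computes_bit (j : 'I_m) : computes (fun i => tnth (bit_tuple i) j) 0.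
Proof.
move=> k mk; exists [::], j; split=> //= [|i vals vk vm].
  by rewrite addn0 (leq_trans (ltn_ord j)).
by rewrite (tnth_nth false) bit_tuple_bits -vm nth_take.
Qed.

Lemma computes_not f c : computes f c -> computes (fun i => ~~ f i) c.+1.
Proof.
move=> fc k mk; have [gs [o [h1 h2 h3 h4]]] := fc k mk.
exists (gs ++ [:: GNot o]), (k + size gs); split.
- by rewrite wf_gates_cat h1 /= h2.
- by rewrite size_cat /= addn1 addnS.
- by rewrite size_cat addn1.
- move=> i vals vk vm; rewrite eval_gates_cat /= nth_rcons size_eval_gates vk.
  by rewrite ltnn eqxx (h4 _ _ vk vm).
Qed.

(** The second circuit is stacked on the first: appending gates changes no earlier wire, so the
    inputs and the first output survive. *)
Lemma computes_pair f1 f2 c1 c2 k : computes f1 c1 -> computes f2 c2 -> m <= k ->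
  exists gs o1 o2, [/\ wf_gates k gs, o1 < k + size gs, o2 < k + size gs,
    size gs <= c1 + c2 &
      forall (i : 'I_(2 ^ m)) vals, size vals = k -> take m vals = bits m i ->
      nth false (eval_gates vals gs) o1 = f1 i /\
      nth false (eval_gates vals gs) o2 = f2 i].
Proof.
move=> fc1 fc2 mk; have [gs1 [o1 [h1 h2 h3 h4]]] := fc1 k mk.
have [gs2 [o2 [k1 k2 k3 k4]]] := fc2 (k + size gs1) (leq_trans mk (leq_addr _ _)).
exists (gs1 ++ gs2), o1, o2; split.
- by rewrite wf_gates_cat h1.
- by rewrite size_cat addnA ltn_addr.
- by rewrite size_cat addnA.
- by rewrite size_cat leq_add.
- move=> i vals vk vm; rewrite eval_gates_cat; split.
    by rewrite nth_eval_gates ?size_eval_gates ?vk // (h4 _ _ vk vm).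
  apply: k4; first by rewrite size_eval_gates vk.
  have sw : m <= size (eval_gates vals gs1) by rewrite size_eval_gates vk (leq_trans mk) ?leq_addr.
  rewrite -vm; apply: (@eq_from_nth _ false) => [|j]; rewrite !size_takel ?vk // => jm.
  by rewrite !nth_take // nth_eval_gates // vk (leq_trans jm).
Qed.

Lemma computes_and f1 f2 c1 c2 : computes f1 c1 -> computes f2 c2 ->
  computes (fun i => f1 i && f2 i) (c1 + c2).+1.
Proof.
move=> fc1 fc2 k mk; have [gs [o1 [o2 [h1 h2 h3 h4 h5]]]] := computes_pair fc1 fc2 mk.
exists (gs ++ [:: GAnd o1 o2]), (k + size gs); split.
- by rewrite wf_gates_cat h1 /= h2 h3.
- by rewrite size_cat /= addn1 addnS.
- by rewrite size_cat addn1.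
- move=> i vals vk vm; rewrite eval_gates_cat /= nth_rcons size_eval_gates vk.
  by have [-> ->] := h5 _ _ vk vm; rewrite ltnn eqxx.
Qed.

Lemma computes_xor f1 f2 c1 c2 : computes f1 c1 -> computes f2 c2 ->
  computes (fun i => f1 i (+) f2 i) (c1 + c2 + 4).
Proof.
move=> fc1 fc2 k mk; have [gs [o1 [o2 [h1 h2 h3 h4 h5]]]] := computes_pair fc1 fc2 mk.
set K := k + size gs in h2 h3.
(* Exclusive or as [(a || b) && ~~ (a && b)], on the four new wires [K] to [K + 3]. *)
exists (gs ++ [:: GOr o1 o2; GAnd o1 o2; GNot (K + 1); GAnd (K + 0) (K + 2)]), (K + 3).
split.
- by rewrite wf_gates_cat h1 /=; lia.
- by rewrite size_cat /=; lia.
- by rewrite size_cat /=; lia.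
- move=> i vals vk vm; rewrite eval_gates_cat /=.
  set w := eval_gates vals gs; have sw : size w = K by rewrite size_eval_gates vk.
  have [e1 e2] : nth false w o1 = f1 i /\ nth false w o2 = f2 i by apply: h5.
  have nl s j : j < K -> nth false (w ++ s) j = nth false w j.
    by rewrite nth_cat sw => ->.
  have nr s j : nth false (w ++ s) (K + j) = nth false s j.
    by rewrite nth_cat sw ltnNge leq_addr addKn.
  rewrite -!cats1 -!catA /= !(nl _ _ h2) !(nl _ _ h3) !nr /= e1 e2.
  by case: (f1 i); case: (f2 i).
Qed.

Hypothesis m_gt0 : 0 < m.

(** There are no constant gates: false is [x && ~~ x] for the first input bit, whence [0 < m]. *)
Lemma computes_cst (b : bool) : computes (fun _ : 'I_(2 ^ m) => b) 3.
Proof.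
have h0 : computes (fun _ : 'I_(2 ^ m) => false) 2.
  have c0 := computes_bit (Ordinal m_gt0).
  by apply: computes_ext (computes_and c0 (computes_not c0)) => i; rewrite andbN.
by case: b; [exact: (computes_not h0)|exact: computes_le h0].
Qed.

Lemma computes_big_xor t (f : 'I_t -> 'I_(2 ^ m) -> bool) c :
  (forall j, computes (f j) c) ->
  computes (fun i => \big[addb/false]_j f j i) (3 + t * (c + 4)).
Proof.
elim: t f => [|t IH] f fc.
  by apply: computes_ext (computes_cst false) => i; rewrite big_ord0.
rewrite (_ : _ + _ = 3 + t * (c + 4) + c + 4); last by rewrite mulSn; lia.
apply: computes_ext (computes_xor (IH _ (fun j => fc (widen_ord (leqnSn t) j))) (fc ord_max)).
by move=> i; rewrite big_ord_recr.
Qed.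

Lemma computes_big_and t (f : 'I_t -> 'I_(2 ^ m) -> bool) c :
  (forall j, computes (f j) c) ->
  computes (fun i => \big[andb/true]_j f j i) (3 + t * c.+1).
Proof.
elim: t f => [|t IH] f fc.
  by apply: computes_ext (computes_cst true) => i; rewrite big_ord0.
rewrite (_ : _ + _ = (3 + t * c.+1 + c).+1); last by rewrite mulSn; lia.
apply: computes_ext (computes_and (IH _ (fun j => fc (widen_ord (leqnSn t) j))) (fc ord_max)).
by move=> i; rewrite big_ord_recr.
Qed.

Lemma computes_parity (g : {set 'I_m} * bool) :
  computes (fun i => parity g (bit_tuple i)) (m * 7 + 10).
Proof.
rewrite (_ : _ + _ = 3 + (3 + m * (3 + 4)) + 4); last by lia.
apply: computes_xor (computes_cst _) _.
apply: (computes_ext (f := fun i => \big[addb/false]_(j < m)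
          ((j \in g.1) && tnth (bit_tuple i) j))) => [i|].
  by rewrite [RHS]big_mkcond; apply: eq_bigr => j _; case: ifP.
apply: computes_big_xor => j; case: (j \in g.1); last exact: computes_cst.
exact: (computes_le _ (computes_bit j)).
Qed.

(** Each row costs a parity of size [7 m + 10], a NOT and an AND; 3 gates start the conjunction. *)
Definition base_cost := 3 + m.+2 * (m * 7 + 12).

Lemma computes_base z : computes (base (@bit_tuple m) z) base_cost.
Proof.
case: z => -[k rows] [] /=; last by apply: computes_le (computes_cst false); rewrite leq_addr.
apply: (computes_ext (f := fun i => \big[andb/true]_(a < m.+2)
          ((a < k) ==> ~~ parity (rows a) (bit_tuple i)))) => [i|].
  by rewrite /base /= /hash big_andE; apply: eq_forallb.
apply: computes_le (_ : 3 + m.+2 * (m * 7 + 11).+1 <= _) _; first by rewrite /base_cost; lia.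
apply: computes_big_and => a; case: (a < k) => /=.
  by apply: computes_le (computes_not (computes_parity (rows a))); lia.
by apply: computes_le (computes_cst true); lia.
Qed.

Lemma gen_circuit t z l : 3 + t * (base_cost + 4) <= l ->
  circuit_size_le m (truth_table (gen (t := t) (@bit_tuple m) z)) l.
Proof.
move=> tl; have [|gs [o [h1 h2 h3 h4]]] :=
  @computes_big_xor t (fun j => base (@bit_tuple m) (z j)) base_cost _ m (leqnn m).
  by move=> j; apply: computes_base.
exists gs, o; split=> //; first exact: leq_trans tl.
move=> i im; rewrite (nth_truth_table _ (Ordinal im)).
by apply: (h4 (Ordinal im)); rewrite ?take_oversize // size_map size_iota.
Qed.

End Computes.

(** * Counting truth tables with small circuits *)

Definition decode_gate w (c : 'I_3 * 'I_w * 'I_w) : gate :=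
  match val c.1.1 with
  | 0 => GAnd c.1.2 c.2
  | 1 => GOr c.1.2 c.2
  | _ => GNot c.1.2
  end.

Lemma decode_gate_onto w g : gate_refs_lt w g -> exists c, decode_gate (w := w) c = g.
Proof.
case: g => [i j /andP[iw jw]|i j /andP[iw jw]|i /= iw].
- by exists (@Ordinal 3 0 isT, Ordinal iw, Ordinal jw).
- by exists (@Ordinal 3 1 isT, Ordinal iw, Ordinal jw).
- by exists (@Ordinal 3 2 isT, Ordinal iw, Ordinal iw).
Qed.

Lemma decode_gates_onto w gs :
  all (gate_refs_lt w) gs -> exists s, map (@decode_gate w) s = gs.
Proof.
elim: gs => [|g gs IH] /=; first by exists [::].
by case/andP=> /decode_gate_onto[c <-] /IH[s <-]; exists (c :: s).
Qed.

Lemma gate_refs_lt_le k w g : k <= w -> gate_refs_lt k g -> gate_refs_lt w g.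
Proof. by move=> kw; case: g => [i j|i j|i] /=; lia. Qed.

Lemma wf_gates_refs k w gs : k + size gs <= w -> wf_gates k gs -> all (gate_refs_lt w) gs.
Proof.
elim: gs k => //= g gs IH k kw /andP[h1 h2].
by rewrite (gate_refs_lt_le _ h1) ?(IH _ _ h2) //; lia.
Qed.

(** Only surjectivity matters for the count, so codes may be redundant or ill-formed: circuits are
    padded to exactly [l] gates, and a forward reference reads the default [false]. *)
Definition decode m l (c : l.-tuple ('I_3 * 'I_(m + l) * 'I_(m + l)) * 'I_(m + l)) :
    {ffun 'I_(2 ^ m) -> bool} :=
  [ffun i => nth false (eval_gates (bits m (val i)) (map (@decode_gate _) c.1)) c.2].

Lemma decode_onto m l (f : {ffun 'I_(2 ^ m) -> bool}) : 0 < m ->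
  circuit_size_le m (truth_table f) l -> exists c, f = @decode m l c.
Proof.
move=> m0 [gs [o [h1 h2 h3 h4]]].
have [|s hs] := @decode_gates_onto (m + l) (gs ++ nseq (l - size gs) (GNot 0)).
  by rewrite all_cat (wf_gates_refs _ h1) ?leq_add2l // all_nseq /= ltn_addr ?orbT.
have sl : size s == l by rewrite -(size_map (@decode_gate _)) hs size_cat size_nseq subnKC.
have ol : o < m + l by apply: leq_trans h2 _; rewrite leq_add2l.
exists (Tuple sl, Ordinal ol); apply/ffunP => i; rewrite ffunE /= hs eval_gates_cat.
rewrite nth_eval_gates ?size_eval_gates ?size_map ?size_iota //.
by rewrite h4 // nth_truth_table.
Qed.

Lemma MCSP_yes_input m l (f : 'I_(2 ^ m) -> bool) : l <= 2 ^ m ->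
  MCSP_yes m (mcsp_input l f) <-> circuit_size_le m (truth_table f) l.
Proof.
move=> lm; rewrite /MCSP_yes mcsp_inputE //.
rewrite drop_size_cat ?size_truth_table // take_size_cat ?size_truth_table //.
split=> [[l' [_ e]]|h]; last by exists l.
suff -> : l = l' by [].
(* The number of ones in the unary half recovers the parameter. *)
have := congr1 (count id) e; rewrite !count_cat !count_nseq /=; lia.
Qed.

Lemma card_mcsp_yes m l (h : (2 ^ m.+1).-tuple bool -> bool) :
  0 < m -> l <= 2 ^ m -> (forall x, h x = true <-> MCSP_yes m x) ->
  #|[set f : {ffun 'I_(2 ^ m) -> bool} | h (mcsp_input l f)]| <=
    (3 * (m + l) * (m + l)) ^ l * (m + l).
Proof.
move=> m0 lm hM; apply: leq_trans (_ : #|codom (@decode m l)| <= _).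
  apply/subset_leq_card/subsetP => f; rewrite inE => /hM/(MCSP_yes_input f lm) hf.
  by have [c ->] := decode_onto m0 hf; apply: codom_f.
by apply: leq_trans (card_size _) _; rewrite size_codom card_prod card_tuple !card_prod !card_ord.
Qed.

(** * Parameters *)

Local Open Scope ring_scope.

Lemma bernoulli (R : realFieldType) (x : R) n : 0 <= x -> 1 + n%:R * x <= (1 + x) ^+ n.
Proof.
move=> x0; elim: n => [|n IH]; first by rewrite mul0r addr0.
rewrite exprS; apply: le_trans (_ : (1 + x) * (1 + n%:R * x) <= _).
  by rewrite -natr1; have : 0 <= n%:R * x ^+ 2; [rewrite mulr_ge0 ?sqr_ge0|nra].
by rewrite ler_wpM2l // addr_ge0.
Qed.

(** With [x = 1 / M], [(1 - x)^M (1 + x)^M <= 1], while Bernoulli gives [(1 + x)^M >= 2]. *)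
Lemma expr_1B_inv_le_half (R : realFieldType) M : (0 < M)%N -> (1 - M%:R^-1) ^+ M <= 2^-1 :> R.
Proof.
move=> M0; set x := M%:R^-1.
have x0 : 0 <= x :> R by rewrite invr_ge0.
have x1 : x <= 1 :> R by rewrite invf_le1 ?ltr0n // ler1n.
have h2 : 2 <= (1 + x) ^+ M :> R.
  by have := bernoulli M x0; rewrite divff // pnatr_eq0 -lt0n.
have h1 : (1 - x) ^+ M * (1 + x) ^+ M <= 1 :> R.
  by rewrite -exprMn exprn_ile1 //; nra.
have h0 : 0 <= (1 - x) ^+ M :> R by rewrite exprn_ge0 // subr_ge0.
nra.
Qed.

Local Open Scope nat_scope.

(** With [m' = m %/ e.+1], both [m.+1 <= e.+1 * 2^m'] and [e.+1^e <= 2^m'], so the power is at most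
    [2^(m' * e.+1)]. *)
Lemma poly_le_exp2 e : exists m0, forall m, m0 <= m -> m.+1 ^ e <= 2 ^ m.
Proof.
exists (e.+1 ^ e * e.+1) => m hm; pose m' := m %/ e.+1.
have hm' : e.+1 ^ e <= m' by rewrite leq_divRL.
apply: (@leq_trans ((e.+1 * 2 ^ m') ^ e)).
  case: (posnP e) => [->//|e0]; rewrite leq_exp2r //.
  apply: leq_trans (_ : e.+1 * m'.+1 <= _); last by rewrite leq_mul2l ltn_expl.
  by rewrite mulnC; apply: ltn_ceil.
rewrite expnMn -expnM; apply: (@leq_trans (2 ^ m' * 2 ^ (m' * e))).
  by rewrite leq_mul2r (leq_trans hm') ?orbT // ltnW // ltn_expl.
by rewrite -expnD -mulnS leq_pexp2l // leq_trunc_div.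
Qed.

Lemma base_cost_le m : 100 <= m -> base_cost m + 4 <= m.+1 ^ 3.
Proof.
move=> m100; rewrite /base_cost !expnS expn0 muln1.
have : 100 * m <= m * m by rewrite leq_mul2r m100 orbT.
have : 100 * (m * m) <= m * (m * m) by rewrite leq_mul2r m100 orbT.
lia.
Qed.

Lemma copies_le m k : 100 <= m -> 0 < k ->
  8 * m.+3 * ((2 * m + 3) * k + 3) <= m.+1 ^ 4 * k.
Proof.
move=> m100 k0; apply: (@leq_trans (8 * m.+3 * ((2 * m + 6) * k))).
  by rewrite leq_mul2l; apply/orP; right; lia.
rewrite mulnA leq_mul2r; apply/orP; right; rewrite !expnS expn0 muln1.
have : 100 * m <= m * m by rewrite leq_mul2r m100 orbT.
have h : 100 * (m * m) <= m * (m * m) by rewrite leq_mul2r m100 orbT.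
have : m * (100 * (m * m)) <= m * (m * (m * m)) by rewrite leq_mul2l h orbT.
lia.
Qed.

(** [k] exceeds [80 n / M^20], whose square exceeds [1600 s]. [t] brings the bias below
    [2^-((2 m + 3) k + 3)], which beats [(2 s + 1)^k] by a factor 8. [l] bounds the circuits of the
    generator, and the last inequality makes the tables with circuits of size [l] a minority. *)
Lemma parameter_bounds m s (n := 2 ^ m) (M := m.+1) (k := (80 * n %/ M ^ 20).+1)
    (t := 8 * m.+3 * ((2 * m + 3) * k + 3)) (l := 3 + t * (base_cost m + 4)) :
  100 <= m -> M ^ 20 <= n -> s * M ^ 40 < (2 ^ m.+1) ^ 2 ->
  [/\ 1600 * s <= k ^ 2, s.*2.+1 <= 2 ^ (2 * m + 3) &
      (2 * m + 4) * l + m + 2 < n].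
Proof.
move=> m100 Mn sM.
have q0 : 0 < M ^ 20 by rewrite expn_gt0.
have nn : (2 ^ m.+1) ^ 2 = 4 * (n * n) by rewrite -mulnn expnS -/n mulnACA.
split.
- have kq : 80 * n < k * M ^ 20 by apply: ltn_ceil.
  rewrite nn (_ : 40 = 20 + 20) // expnD in sM.
  move: sM kq q0; set q := M ^ 20; rewrite -(mulnn k) => sM kq q0.
  have h1 : (80 * n) * (80 * n) <= (k * q) * (k * q) by rewrite leq_mul // ltnW.
  have h2 : 1600 * s * (q * q) <= k * k * (q * q).
    rewrite [leqRHS]mulnACA; apply: leq_trans h1; rewrite -mulnA [leqRHS]mulnACA.
    by move: sM; set a := n * n; set b := s * (q * q); clear; lia.
  by rewrite -(leq_pmul2r (_ : 0 < q * q)) // muln_gt0 q0.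
- have : s <= s * M ^ 40 by rewrite leq_pmulr // expn_gt0.
  have -> : 2 ^ (2 * m + 3) = 8 * (n * n) by rewrite expnD mul2n -addnn expnD mulnC.
  by move: sM; rewrite nn; move: (s * _) (n * n) => a b; clear; lia.
- have k0 : 0 < k by [].
  have hl : l <= M ^ 8 * k.
    have h : t * (base_cost m + 4) <= M ^ 7 * k.
      apply: leq_trans (leq_mul (copies_le m100 k0) (base_cost_le m100)) _.
      by rewrite mulnAC -expnD.
    have b0 : 0 < M ^ 7 * k by rewrite muln_gt0 expn_gt0.
    rewrite /l (expnS M 7) -mulnA; move: h b0; move: (t * _) (M ^ 7 * k) => a b h b0.
    by apply: (@leq_trans (100 * b)); rewrite ?leq_mul2r; move: h b0 m100; rewrite /M; clear; lia.
  have hM : (2 * m + 4) * l + m + 2 < M ^ 10 * k.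
    have -> : M ^ 10 * k = M * (M * (M ^ 8 * k)) by rewrite (expnS M 9) (expnS M 8) -2!mulnA.
    have : 0 < M ^ 8 * k by rewrite muln_gt0 expn_gt0.
    move: hl m100; rewrite /M; move: l (_ ^ 8 * k) => a b hl m100 b0; clear -hl m100 b0.
    have h1 : (2 * m + 4) * a <= (2 * m + 4) * b by rewrite leq_mul2l hl orbT.
    have h2 : 100 * (m.+1 * b) <= m.+1 * (m.+1 * b) by rewrite leq_mul2r orbC leqW.
    have h3 : m.+1 <= m.+1 * b by rewrite leq_pmulr.
    have h4 : b <= m.+1 * b by rewrite leq_pmull.
    by rewrite -addnA; apply: leq_ltn_trans (leq_add h1 (leqnn _)) _; clear h1; lia.
  (* After multiplication by [M^10]: [M^20 * k <= M^20 + 80 n <= 81 n], below [M^10 * n]. *)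
  apply: leq_trans hM _; rewrite -(leq_pmul2l (_ : 0 < M ^ 10)) ?expn_gt0 //.
  have h : 100 * n <= M ^ 10 * n.
    rewrite leq_mul2r (expnS M 9) (leq_trans (_ : 100 <= M * 1)) ?orbT //.
      by rewrite muln1 leqW.
    by rewrite leq_mul2l expn_gt0.
  apply: leq_trans h; rewrite mulnA -expnD mulnS mulnC.
  apply: (@leq_trans (n + 80 * n)); last by rewrite -mulSn leq_mul2r orbT.
  exact: (leq_add Mn (leq_trunc_div _ _)).
Qed.

(* Inputs of MCSP have length N = 2^(m+1) (truth table of 2^m bits plus the
   unary size parameter padded to 2^m bits). s >= N^2 / polylog(N) is stated as
   N^2 <= s * (log2 N)^c for a constant c, for all large enough N. *)
Theorem theorem4p10 :
  exists c N0 : nat, forall m s : nat,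
    N0 <= 2 ^ m.+1 ->
    forall h : (2 ^ m.+1).-tuple bool -> bool,
      (forall x, h x = true <-> MCSP_yes m x) ->
      in_FORMULA_XOR s h ->
      (2 ^ m.+1) ^ 2 <= s * (trunc_log 2 (2 ^ m.+1)) ^ c.
Proof.
have [m0 hm0] := poly_le_exp2 20.
(* [m0] ensures [m.+1^20 <= 2^m], and 100 the crude polynomial estimates; the exponent 40 is twice
   20 because [k^2] is compared with [s]. *)
exists 40, (2 ^ (m0 + 100).+1) => m s; rewrite (@leq_exp2l 2 _ _ isT) ltnS => hm h hM hF.
rewrite (@trunc_expnK 2 m.+1 isT) leqNgt; apply/negP => sM.
have m100 : 100 <= m := leq_trans (leq_addl _ _) hm.
have Mn : m.+1 ^ 20 <= 2 ^ m := hm0 _ (leq_trans (leq_addr _ _) hm).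
have mgt0 : 0 < m := leq_trans (isT : 0 < 100) m100.
have [hk hs hl] := parameter_bounds m100 Mn sM.
set k := (80 * 2 ^ m %/ m.+1 ^ 20).+1 in hk hl.
set e := (2 * m + 3) * k + 3 in hl.
set t := 8 * m.+3 * e in hl; set l := 3 + t * (base_cost m + 4) in hl.
have ln : l <= 2 ^ m.
  apply: leq_trans (ltnW hl); rewrite -addnA; apply: leq_trans (leq_addr _ _).
  by apply: leq_pmull; rewrite addnS.
have cs : 0 < #|{: seed m}| by apply/card_gt0P; exists (ord0, [ffun=> (set0, true)], true).
have Z0 : 0 < #|{: {ffun 'I_t -> seed m}}| by rewrite card_ffun expn_gt0 cs.
have U0 : 0 < #|{: {ffun 'I_(2 ^ m) -> bool}}| by rewrite card_ffun expn_gt0 card_bool.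
have zyes (z : {ffun 'I_t -> seed m}) : h (mcsp_input l (gen (@bit_tuple m) z)).
  by apply/hM/MCSP_yes_input => //; apply: gen_circuit.
(* Real algebraic numbers supply the square roots taken at the leaves of the certificate. *)
have := formula_xor_fooled hF (ltn0Sn _) hk Z0 U0 (@gen_fools realalg m l t) _ zyes.
have eps : ((1 - (8 * m.+3)%:R^-1) ^+ t * (s.*2.+1)%:R ^+ k <= 1 / 8 :> realalg)%R.
  apply: (@le_trans _ _ (2^-1 ^+ e * 2 ^+ ((2 * m + 3) * k))%R).
    apply: ler_pM; rewrite ?exprn_ge0 ?subr_ge0 ?invf_le1 ?ltr0n ?ler1n //.
      rewrite /t exprM lerXn2r ?nnegrE ?invr_ge0 ?exprn_ge0 //.
        by rewrite subr_ge0 invf_le1 ?ltr0n // ler1n.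
      exact: expr_1B_inv_le_half.
    by rewrite exprM lerXn2r ?nnegrE ?exprn_ge0 // -natrX ler_nat.
  rewrite exprD mulrAC -exprMn mulVf ?pnatr_eq0 // expr1n mul1r.
  by rewrite !exprS expr0; lra.
(* It remains to contradict acceptance of half of all truth tables: twice the number of codes is
   below [2^(2^m)]. *)
move/(_ eps); apply/negP; rewrite -ltNge /mean -natr_sum.
rewrite ltr_pdivrMr ?ltr0n // [ltRHS]mulrC mulrA mulr1 ltr_pdivlMr ?ltr0n //.
rewrite -natrM ltr_nat -big_mkcond /= sum1_card.
apply: (@leq_ltn_trans ((3 * (m + l) * (m + l)) ^ l * (m + l) * 2)).
  rewrite leq_mul2r /=; apply: leq_trans (card_mcsp_yes mgt0 ln hM).
  by rewrite cardsE.
rewrite card_ffun card_bool card_ord.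
apply: (@leq_ltn_trans (2 ^ ((2 * m + 4) * l + m + 2))); last by rewrite ltn_exp2l.
have ml : m + l <= 2 ^ m.+1 by rewrite expnS mul2n -addnn leq_add // ltnW // ltn_expl.
rewrite addn2 expnSr leq_mul2r /= -addnS expnD leq_mul // expnM.
case: (posnP l) => [->//|l0]; rewrite leq_exp2r //.
(* Each gate has at most [3 (m + l)^2] codes, and [m + l <= 2^(m+1)]. *)
rewrite (_ : 2 ^ (2 * m + 4) = 4 * 2 ^ m.+1 * 2 ^ m.+1); last first.
  by rewrite -mulnA -expnD (_ : 4 = 2 ^ 2) // -expnD; congr (2 ^ _); lia.
by rewrite leq_mul // leq_mul.
Qed.
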